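(* Let $i\in\{2,3\}$ and let $(G_i,g_i)$ be the initial algebra of $F_i$ on $\mathbf{MS}_i^{S}$. Then $(G_i,g_i)$ is not the initial algebra of $F_i$ on $\mathbf{MS}_i^{C}$, and $(G_i,g_i)$ is not the initial algebra of $F_i$ on $\mathbf{MS}_i^{L}$.
   Context: **Pointed sets and metric spaces.** A bi-pointed set is $(X,\top,\bot)$, a set with two distinguished elements; a tri-pointed set is $(X,T,L,R)$, a set with three distinguished elements. An $i$-pointed metric space is an $i$-pointed set with a metric $d\le 1$ such that distinct distinguished elements are at distance $1$. $\mathbf{MS}_i^{S}$, $\mathbf{MS}_i^{L}$, $\mathbf{MS}_i^{C}$ are the categories of $i$-pointed metric spaces with, respectively, short maps (i.e. $1$-Lipschitz maps), Lipschitz maps, and continuous maps preserving the distinguished elements. **The functors.** $M_2=\{l,r\}$, $M_3=\{a,b,c\}$. $M_2\otimes X$ is the quotient of $M_2\times X$ by the equivalence relation generated by $(l,\top)\sim(r,\bot)$, with $\bot_{M_2\otimes X}=l\otimes\bot$, $\top_{M_2\otimes X}=r\otimes\top$. $M_3\otimes X$ is the quotient of $M_3\times X$ by the equivalence relation generated by $(b,T)\sim(a,L)$, $(a,R)\sim(c,T)$, $(c,L)\sim(b,R)$, with distinguished elements $T=a\otimes T$, $L=b\otimes L$, $R=c\otimes R$. Here $m\otimes x$ is the class of $(m,x)$. Put $F_iX=M_i\otimes X$ and $F_if=M_i\otimes f$, $(M_i\otimes f)(m\otimes x)=m\otimes f(x)$. If $X$ is an $i$-pointed metric space, $M_i\times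 X$ has the metric equal to $\frac12 d(x,y)$ between $(m,x),(m,y)$ and $1$ between $(m,x),(n,y)$ with $m\ne n$, and $M_i\otimes X$ carries the quotient metric. Explicitly $d(m\otimes x,m\otimes y)=\frac12 d(x,y)$; for $i=2$, $d(l\otimes x,r\otimes y)=\frac12(d(x,\top)+d(\bot,y))$; for $i=3$, $d(a\otimes x,b\otimes y)=\frac12\min\{d(x,L)+d(T,y),\,d(x,R)+1+d(R,y)\}$, $d(a\otimes x,c\otimes y)=\frac12\min\{d(x,R)+d(T,y),\,d(x,L)+1+d(L,y)\}$, $d(b\otimes x,c\otimes y)=\frac12\min\{d(x,R)+d(L,y),\,d(x,T)+1+d(T,y)\}$. This makes $F_i$ an endofunctor on each of these categories. **Algebras.** An $F_i$ algebra is an object $X$ with a morphism $e:M_i\otimes X\to X$ of the category; a morphism $(X,e)\to(Y,e')$ is a morphism $f:X\to Y$ with $f\circ e=e'\circ(M_i\otimes f)$; an initial algebra is an initial object in the category of algebras. **The algebra $(G_i,g_i)$.** Let $I$ be the initial object (the set of $i$ distinguished points, at mutual distance $1$) and $!:I\to M_i\otimes I$ the unique morphism. $G_i$ is the colimit of the chain of isometric embeddings $I\to M_i\otimes I\to M_i^2\otimes I\to\cdots$ with maps $M_i^n\otimes !$, where $M_i^{n+1}\otimes I=M_i\otimes(M_i^n\otimes I)$; its elements are classes $[m_1\otimes\cdots\otimes m_k\otimes d]$ with $m_j\in M_i$, $d\in I$, it carries the induced metric, and the maps $M_i^n\otimes I\to G_i$ are isometric embeddings. The structure map is $g_i:M_i\otimes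 G_i\to G_i$, $g_i(m\otimes[x])=[m\otimes x]$. It is known that $(G_i,g_i)$ is the initial algebra of $F_i$ on $\mathbf{MS}_i^{S}$. (For $i=2$ it is isomorphic to the set $D$ of dyadic rationals in $[0,1]$ with $\phi(l\otimes x)=x/2$, $\phi(r\otimes x)=(x+1)/2$, $\bot=0$, $\top=1$.) *)

(* Defs.v *)
From HB Require Import structures.
From Stdlib Require Import Relation_Operators.
From mathcomp Require Import all_boot all_order all_algebra.
From mathcomp Require Import all_classical all_reals all_analysis.
From mathcomp Require Import lra zify.
Set Implicit Arguments.
Unset Strict Implicit.
Unset Printing Implicit Defensive.
Import Order.TTheory GRing.Theory Num.Theory.
Local Open Scope ring_scope.
Local Open Scope quotient_scope.

(* Everything is parametrised by the number i of distinguished points, the    *)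
(* cases of interest being i = 2 and i = 3.  Both the set M_i and the set of  *)
(* names of distinguished points are 'I_i:                                    *)
(*   i = 2 :  l, r    = 0, 1      and   bot, top = 0, 1                       *)
(*   i = 3 :  a, b, c = 0, 1, 2   and   T, L, R  = 0, 1, 2                    *)
(* With this numbering the distinguished point j of M_i (x) X is j (x) pt j,  *)
(* and the generating identifications are (m, pt n) ~ (n, pt m) for m != n:   *)
(*   i = 2 :  (l, top) ~ (r, bot)                                             *)
(*   i = 3 :  (b, T) ~ (a, L),  (a, R) ~ (c, T),  (c, L) ~ (b, R)             *)

Record ptMetric (R : realType) (i : nat) := PtMetric {
  carrier :> metricType R ;
  pt : 'I_i -> carrier ;
  mdist_le1 : forall x y : carrier, mdist x y <= 1 ;
  mdist_pt : forall j k, j != k -> mdist (pt j) (pt k) = 1 }.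

Arguments pt {R i} _ _.
Arguments mdist_le1 {R i} _ _ _.
Arguments mdist_pt {R i} _ _ _ _.

Section Morphisms.
Context {R : realType} {i : nat}.

Definition pointed (X Y : ptMetric R i) (f : X -> Y) :=
  forall j, f (pt X j) = pt Y j.

Definition lipschitzWith (k : R) (X Y : ptMetric R i) (f : X -> Y) :=
  forall x y, mdist (f x) (f y) <= k * mdist x y.

End Morphisms.

(* The three categories differ only in their morphisms. *)
Variant category := MS_S | MS_L | MS_C.

Definition morphism {R : realType} {i : nat} (K : category)
    (X Y : ptMetric R i) (f : X -> Y) : Prop :=
  pointed f /\
  match K with
  | MS_S => lipschitzWith 1 f
  | MS_L => exists k, lipschitzWith k f
  | MS_C => continuous f
  end.

(* -------------------------------------------------------------------------- *)

Section Tensor.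
Context {R : realType} {i : nat} (X : ptMetric R i).
Local Notation MX := ('I_i * X)%type.
Implicit Types p q : MX.

Inductive glue : MX -> MX -> Prop :=
  Glue m n : m != n -> glue (m, pt X n) (n, pt X m).

Definition tensRel p q : bool := `[< clos_refl_sym_trans MX glue p q >].

Lemma tensRel_is_equiv : equiv_class_of tensRel.
Proof.
split.
- by move=> p; apply/asboolP; apply: rst_refl.
- by move=> p q; apply/asboolP/asboolP; apply: rst_sym.
- move=> q p r /asboolP pq /asboolP qr; apply/asboolP.
  exact: rst_trans pq qr.
Qed.

Canonical tensRel_equiv := EquivRelPack tensRel_is_equiv.

Lemma glueP p q :
  glue p q <-> [/\ p.1 != q.1, p.2 = pt X q.1 & q.2 = pt X p.1].
Proof.
split=> [[m n mn] //|]; case: p q => [m x] [n y] /= [mn -> ->].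
exact: Glue.
Qed.

Lemma pt_inj : injective (pt X).
Proof.
move=> j k e; apply/eqP; apply: contraT => jk.
by have := mdist_pt X _ _ jk; rewrite e mdistxx => /eqP; rewrite eq_sym oner_eq0.
Qed.

Lemma tensRelP p q : tensRel p q <-> p = q \/ glue p q.
Proof.
split=> [/asboolP|[->|pq]]; last 2 first.
- exact/asboolP/rst_refl.
- exact/asboolP/rst_step.
elim=> {p q} [p q pq|p|p q _ [->|]|p q r _ [->|pq] _ [<-|qr]];
  do ?[by left | by right].
- by move=> /glueP[ne e1 e2]; right; apply/glueP; rewrite eq_sym.
- left; move/glueP: pq => [_ e1 e2]; move/glueP: qr => [_ e3 e4].
  case: p r e1 e2 e3 e4 => [m x] [n y] /= -> -> /pt_inj -> ->.
  by [].
Qed.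

Definition tensCarrier := {eq_quot tensRel}.
HB.instance Definition _ := Choice.on tensCarrier.
HB.instance Definition _ := EqQuotient.on tensCarrier.

Definition tens (m : 'I_i) (x : X) : tensCarrier := \pi_tensCarrier (m, x).

Definition copiesDist p q : R :=
  if p.1 == q.1 then mdist p.2 q.2 / 2 else 1.

(* [linked p q r]: there are a chain p ~ p_1, q_1 ~ p_2, ..., q_k ~ q with    *)
(* r = d(p_1, q_1) + ... + d(p_k, q_k), where d is the metric of M x X.       *)
Inductive linked p : MX -> R -> Prop :=
| linked0 q : tensRel p q -> linked p q 0
| linkedS q q' q'' r :
    linked p q r -> tensRel q' q'' -> linked p q'' (r + copiesDist q q').

(* The quotient metric. *)
Definition tensDist (u v : tensCarrier) : R :=
  inf [set r | linked (repr u) (repr v) r].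

(* Its explicit form. *)
Definition tensForm p q : R :=
  if p.1 == q.1 then mdist p.2 q.2 / 2 else
  (\big[Num.min/(mdist p.2 (pt X q.1) + mdist (pt X p.1) q.2)]_(k
      | (k != p.1) && (k != q.1))
     (mdist p.2 (pt X k) + 1 + mdist (pt X k) q.2)) / 2.

Variant tensForm_spec p q : R -> Prop :=
| TensFormEq : p.1 = q.1 -> tensForm_spec p q (mdist p.2 q.2 / 2)
| TensFormDirect : p.1 != q.1 ->
    tensForm_spec p q ((mdist p.2 (pt X q.1) + mdist (pt X p.1) q.2) / 2)
| TensFormVia k : p.1 != q.1 -> k != p.1 -> k != q.1 ->
    tensForm_spec p q ((mdist p.2 (pt X k) + 1 + mdist (pt X k) q.2) / 2).

Lemma tensFormP p q : tensForm_spec p q (tensForm p q).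
Proof.
rewrite /tensForm; case: eqVneq => [e|ne]; first exact: TensFormEq.
elim/big_rec: _ => [|k r /andP[kp kq] IH]; first exact: TensFormDirect.
by case: leP => // _; exact: TensFormVia.
Qed.

Lemma tensForm_le p q s : tensForm_spec p q s -> tensForm p q <= s.
Proof.
rewrite /tensForm => -[->|ne|k ne kp kq]; first by rewrite eqxx.
- by rewrite (negPf ne) ler_pM2r ?invr_gt0// bigmin_le_id.
- rewrite (negPf ne) ler_pM2r ?invr_gt0//.
  by apply: bigmin_le_cond; rewrite kp kq.
Qed.

Lemma tensForm_ge0 p q : 0 <= tensForm p q.
Proof.
by case: tensFormP => *; rewrite divr_ge0// ?addr_ge0// mdist_ge0.
Qed.

Lemma tensForm_le1 p q : tensForm p q <= 1.
Proof.
have [e|ne] := eqVneq p.1 q.1.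
  apply: le_trans (tensForm_le (TensFormEq e)) _.
  by have := mdist_le1 X p.2 q.2; lra.
apply: le_trans (tensForm_le (TensFormDirect ne)) _.
have := mdist_le1 X p.2 (pt X q.1); have := mdist_le1 X (pt X p.1) q.2; lra.
Qed.

Lemma tensFormxx p : tensForm p p = 0.
Proof. by rewrite /tensForm eqxx mdistxx mul0r. Qed.

Lemma tensForm_sym p q : tensForm p q = tensForm q p.
Proof.
suff le a b : tensForm a b <= tensForm b a by apply/le_anti; rewrite !le.
case: (tensFormP b a) => [e|ne|k ne kb ka].
- by rewrite metric_sym; apply: tensForm_le; constructor.
- rewrite eq_sym in ne; have := tensForm_le (TensFormDirect ne).
  rewrite [mdist a.2 _]metric_sym [mdist _ b.2]metric_sym.
  by rewrite addrC.
- rewrite eq_sym in ne; have := tensForm_le (TensFormVia ne ka kb).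
  by rewrite [mdist a.2 _]metric_sym [mdist _ b.2]metric_sym; lra.
Qed.

Lemma tensForm_glue p m n : m != n ->
  tensForm p (m, pt X n) <= tensForm p (n, pt X m).
Proof.
move=> mn; case: (tensFormP p (n, pt X m)) => /= [e|pn|k pn kp kn].
- apply: le_trans (tensForm_le (TensFormDirect _)) _ => /=.
    by rewrite e eq_sym.
  by rewrite e mdistxx addr0.
- have [e|pm] := eqVneq p.1 m.
    apply: le_trans (tensForm_le (TensFormEq _)) _ => //=.
    by rewrite e mdistxx addr0.
  apply: le_trans (tensForm_le (@TensFormVia _ _ n _ _ _)) _ => //=;
    rewrite 1?eq_sym//.
  by rewrite mdistxx addr0 mdist_pt.
- have [e|pm] := eqVneq p.1 m.
    apply: le_trans (tensForm_le (TensFormEq _)) _ => //=.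
    rewrite ler_pM2r ?invr_gt0//.
    have := mdist_le1 X p.2 (pt X n); have := mdist_ge0 p.2 (pt X k).
    have := mdist_ge0 (pt X k) (pt X m); lra.
  have [->|km] := eqVneq k m.
    apply: le_trans (tensForm_le (TensFormDirect _)) _ => //=.
    by rewrite mdistxx addr0 mdist_pt.
  apply: le_trans (tensForm_le (@TensFormVia _ _ k _ _ _)) _ => //=.
  by rewrite !mdist_pt.
Qed.

Lemma tensForm_rel p q q' : tensRel q q' -> tensForm p q = tensForm p q'.
Proof.
move=> /tensRelP[->//|[m n mn]].
by apply/le_anti; rewrite !tensForm_glue// eq_sym.
Qed.

Lemma tensForm_step p q q' :
  tensForm p q' <= tensForm p q + copiesDist q q'.
Proof.
rewrite /copiesDist; case: eqVneq => [e|_]; last first.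
  by have := tensForm_le1 p q'; have := tensForm_ge0 p q; lra.
case: (tensFormP p q) => [e1|ne|k ne kp kq].
- apply: le_trans (tensForm_le (TensFormEq _)) _; first by rewrite e1.
  by have := metric_triangle p.2 q.2 q'.2; lra.
- apply: le_trans (tensForm_le (TensFormDirect _)) _; rewrite -?e//.
  by have := metric_triangle (pt X p.1) q.2 q'.2; lra.
- apply: le_trans (tensForm_le (@TensFormVia _ _ k _ _ _)) _; rewrite -?e//.
  by have := metric_triangle (pt X k) q.2 q'.2; lra.
Qed.

Lemma tensForm_linked p q q' r :
  linked q q' r -> tensForm p q' <= tensForm p q + r.
Proof.
elim=> {q'} [q' /tensForm_rel <-|q1 q2 q3 {}r _ IH /tensForm_rel <-].
  by rewrite addr0.
by apply: le_trans (tensForm_step p q1 q2) _; rewrite addrA lerD2r.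
Qed.

Lemma linked_tensForm p q : linked p q (tensForm p q).
Proof.
have refl a : tensRel a a by apply/tensRelP; left.
have rel m n : m != n -> tensRel (m, pt X n) (n, pt X m).
  by move=> mn; apply/tensRelP; right.
case: p q => [m x] [n y]; case: tensFormP => /= [<-|mn|k mn km kn].
- have := linkedS (linked0 (refl (m, x))) (refl (m, y)).
  by rewrite /copiesDist/= eqxx add0r.
- have := linkedS (linked0 (refl (m, x))) (rel _ _ mn).
  move=> /linkedS /(_ (refl (n, y))).
  by rewrite /copiesDist/= !eqxx add0r -mulrDl.
- rewrite eq_sym in km; have := linkedS (linked0 (refl (m, x))) (rel _ _ km).
  move=> /linkedS /(_ (rel _ _ kn)) /linkedS /(_ (refl (n, y))).
  rewrite /copiesDist/= !eqxx add0r -!mulrDl mdist_pt//.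
Qed.

Lemma tensForm_triangle p q r :
  tensForm p r <= tensForm p q + tensForm q r.
Proof. exact/tensForm_linked/linked_tensForm. Qed.

Lemma tensForm_eq0 p q : tensForm p q = 0 -> tensRel p q.
Proof.
have h (a : R) : a / 2 = 0 -> a = 0 by lra.
case: p q => [m x] [n y].
case: tensFormP => /= [<-|mn|k mn km kn] /h e; apply/tensRelP.
- by left; congr pair; apply: mdist_positivity.
- right; apply/glueP; split=> //=; first apply: mdist_positivity;
    last (apply: mdist_positivity; rewrite metric_sym); move: e;
    have := mdist_ge0 x (pt X n); have := mdist_ge0 (pt X m) y; lra.
- exfalso; move: e.
  by have := mdist_ge0 x (pt X k); have := mdist_ge0 (pt X k) y; lra.
Qed.

Lemma tensDist_pi p q :
  tensDist (\pi_tensCarrier p) (\pi_tensCarrier q) = tensForm p q.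
Proof.
rewrite /tensDist; set p' := repr _; set q' := repr _.
have pp' : tensRel p p' by apply/eqmodP; rewrite reprK.
have qq' : tensRel q q' by apply/eqmodP; rewrite reprK.
rewrite (tensForm_rel _ qq') tensForm_sym (tensForm_rel _ pp') tensForm_sym.
apply/le_anti/andP; split.
  apply: ge_inf; last exact: linked_tensForm.
  exists 0 => r /(tensForm_linked p'); rewrite tensFormxx add0r.
  exact/le_trans/tensForm_ge0.
apply: lb_le_inf; first by exists (tensForm p' q'); exact: linked_tensForm.
by move=> r /(tensForm_linked p'); rewrite tensFormxx add0r.
Qed.

Fact tensDistxx u : tensDist u u = 0.
Proof. by rewrite -(reprK u) tensDist_pi tensFormxx. Qed.

Fact tensDist_positivity u v : tensDist u v = 0 -> u = v.
Proof.
rewrite -(reprK u) -(reprK v) tensDist_pi => /tensForm_eq0 ?.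
exact/eqmodP.
Qed.

Fact tensDist_sym u v : tensDist u v = tensDist v u.
Proof. by rewrite -(reprK u) -(reprK v) !tensDist_pi tensForm_sym. Qed.

Fact tensDist_triangle v u w : tensDist u w <= tensDist u v + tensDist v w.
Proof.
rewrite -(reprK u) -(reprK v) -(reprK w) !tensDist_pi.
exact: tensForm_triangle.
Qed.

HB.instance Definition _ := isMetric.Build R tensCarrier
  tensDistxx tensDist_positivity tensDist_sym tensDist_triangle.

Fact tensDist_le1 (u v : tensCarrier) : mdist u v <= 1.
Proof. by rewrite -(reprK u) -(reprK v) [mdist _ _]tensDist_pi tensForm_le1. Qed.

Fact tensDist_pt j k : j != k ->
  mdist (tens j (pt X j)) (tens k (pt X k)) = 1.
Proof.
move=> jk; rewrite [mdist _ _]tensDist_pi.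
apply/le_anti/andP; split; first exact: tensForm_le1.
case: tensFormP => /= [/eqP|_|l _ lj lk]; first by rewrite (negPf jk).
  by rewrite mdist_pt//; lra.
by rewrite mdist_pt 1?eq_sym// mdist_pt//; lra.
Qed.

Definition tensor : ptMetric R i :=
  @PtMetric R i tensCarrier (fun j => tens j (pt X j)) tensDist_le1 tensDist_pt.

Lemma tensor_ind (P : tensor -> Prop) : (forall m x, P (tens m x)) ->
  forall u, P u.
Proof. by move=> h u; rewrite -[u]reprK; case: (repr u) => m x; apply: h. Qed.

Lemma mdist_tens m x n y :
  mdist (tens m x : tensor) (tens n y) = tensForm (m, x) (n, y).
Proof. exact: tensDist_pi. Qed.

Lemma tens_glue m n : tens m (pt X n) = tens n (pt X m) :> tensor.
Proof.
have [->//|mn] := eqVneq m n.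
by apply/eqmodP/tensRelP; right.
Qed.

End Tensor.

Arguments tensor {R i} X.

(* For i = 3, k is the name of the third copy, different from m and n.        *)
Section ExplicitMetric.
Context {R : realType}.

Lemma mdist_tens_same i (X : ptMetric R i) m (x y : X) :
  mdist (tens m x : tensor X) (tens m y) = mdist x y / 2.
Proof. by rewrite mdist_tens /tensForm/= eqxx. Qed.

Lemma mdist_tens2 (X : ptMetric R 2) (x y : X) (m n : 'I_2) : m != n ->
  mdist (tens m x : tensor X) (tens n y) =
  (mdist x (pt X n) + mdist (pt X m) y) / 2.
Proof.
move=> mn; rewrite mdist_tens /tensForm/= (negPf mn) big_pred0// => k.
by case: m n k mn => [[|[|//]] ?] [[|[|//]] ?] [[|[|//]] ?].
Qed.

Lemma mdist_tens3 (X : ptMetric R 3) (x y : X) (m n k : 'I_3) :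
  uniq [:: m; n; k] ->
  mdist (tens m x : tensor X) (tens n y) =
  Num.min (mdist x (pt X n) + mdist (pt X m) y)
          (mdist x (pt X k) + 1 + mdist (pt X k) y) / 2.
Proof.
rewrite /= !inE negb_or andbT => /andP[/andP[mn mk] nk].
rewrite mdist_tens /tensForm/= (negPf mn).
rewrite (bigminD1 k) /=; last by rewrite ![k == _]eq_sym mk nk.
rewrite big_pred0 ?[LHS]minC 1?minC// => j.
by case: m n k j mn mk nk => [[|[|[|//]]] ?] [[|[|[|//]]] ?] [[|[|[|//]]] ?]
  [[|[|[|//]]] ?].
Qed.

End ExplicitMetric.

(* -------------------------------------------------------------------------- *)

Section TensorMap.
Context {R : realType} {i : nat}.
Implicit Types X Y Z : ptMetric R i.

Definition tensMap X Y (f : X -> Y) (u : tensor X) : tensor Y :=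
  let p := repr (u : tensCarrier X) in tens p.1 (f p.2).

Lemma tensMapE X Y (f : X -> Y) m x : pointed f ->
  tensMap f (tens m x) = tens m (f x).
Proof.
move=> fpt; rewrite /tensMap.
have /eqmodP/tensRelP := reprK (tens m x).
case: (repr _) => m' x' [[-> ->//]|/glueP[/= _ -> ->]].
by rewrite !fpt tens_glue.
Qed.

Lemma tensMap_pointed X Y (f : X -> Y) : pointed f -> pointed (tensMap f).
Proof. by move=> fpt j; rewrite tensMapE// fpt. Qed.

Lemma tensForm_isom X Y (f : X -> Y) : pointed f ->
  (forall x y, mdist (f x) (f y) = mdist x y) ->
  forall m x n y, tensForm (m, f x) (n, f y) = tensForm (m, x) (n, y).
Proof.
move=> fpt fi m x n y; rewrite /tensForm/=; case: ifP => _; first by rewrite fi.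
rewrite -!fpt !fi; congr (_ / 2); apply: eq_bigr => k _.
by rewrite -!fpt !fi.
Qed.

Lemma tensMap_isom X Y (f : X -> Y) : pointed f ->
  (forall x y, mdist (f x) (f y) = mdist x y) ->
  forall u v, mdist (tensMap f u) (tensMap f v) = mdist u v.
Proof.
move=> fpt fi; apply: tensor_ind => m x; apply: tensor_ind => n y.
by rewrite !tensMapE// !mdist_tens tensForm_isom.
Qed.

Lemma tensMap_short X Y (f : X -> Y) :
  morphism MS_S f -> morphism MS_S (tensMap f).
Proof.
move=> [fpt fs]; split; first exact: tensMap_pointed.
have {}fs x y : mdist (f x) (f y) <= mdist x y.
  by have := fs x y; rewrite mul1r.
apply: tensor_ind => m x; apply: tensor_ind => n y; rewrite mul1r.
rewrite !tensMapE// !mdist_tens.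
case: (tensFormP (m, x) (n, y)) => /= [e|ne|k ne kp kq].
- apply: le_trans (tensForm_le (TensFormEq _)) _ => //=.
  by rewrite ler_pM2r ?invr_gt0.
- apply: le_trans (tensForm_le (TensFormDirect _)) _ => //=.
  by rewrite -!fpt ler_pM2r ?invr_gt0// lerD.
- apply: le_trans (tensForm_le (@TensFormVia _ _ _ _ _ k _ _ _)) _ => //=.
  by rewrite -!fpt ler_pM2r ?invr_gt0// !lerD.
Qed.

Lemma morphism_of_S K X Y (f : X -> Y) : morphism MS_S f -> morphism K f.
Proof.
move=> [fpt fs]; split=> //; case: K => //; first by exists 1.
move=> x; apply/(@metricType_numDomainType.cvgrPdist_lt R Y) => e e0.
apply/(@metricType_numDomainType.nbhs_mdistP R X); exists e => //= y xy.
by rewrite (le_lt_trans (fs _ _))// mul1r.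
Qed.

Lemma morphism_comp_S X Y Z (f : X -> Y) (g : Y -> Z) :
  morphism MS_S f -> morphism MS_S g -> morphism MS_S (g \o f).
Proof.
move=> [fpt fs] [gpt gs]; split=> [j|x y] /=; first by rewrite fpt gpt.
by apply: le_trans (gs _ _) _; rewrite mul1r.
Qed.

End TensorMap.

Section Algebras.
Context {R : realType} {i : nat}.

Record algebra (K : category) := Algebra {
  obj :> ptMetric R i ;
  str : tensor obj -> obj ;
  str_morphism : morphism K str }.

Definition algMorphism K (A B : algebra K) (f : A -> B) : Prop :=
  morphism K f /\ f \o str (a := A) = str (a := B) \o tensMap f.

Definition isInitialAlgebra K (A : algebra K) : Prop :=
  forall B : algebra K, exists! f : A -> B, algMorphism f.

End Algebras.

Arguments algebra R i K : clear implicits.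

(* -------------------------------------------------------------------------- *)

Section InitialObject.
Context {R : realType} {i : nat}.

Definition initCarrier := 'I_i.
HB.instance Definition _ := Choice.on initCarrier.

Definition initDist (j k : initCarrier) : R := (j != k)%:R.

Fact initDistxx j : initDist j j = 0.
Proof. by rewrite /initDist eqxx. Qed.
Fact initDist_positivity j k : initDist j k = 0 -> j = k.
Proof. by rewrite /initDist; case: eqVneq => //= _ /eqP; rewrite oner_eq0. Qed.
Fact initDist_sym j k : initDist j k = initDist k j.
Proof. by rewrite /initDist eq_sym. Qed.
Fact initDist_triangle k j l : initDist j l <= initDist j k + initDist k l.
Proof.
rewrite /initDist; have [<-|jk] := eqVneq j k; first by rewrite add0r.
by rewrite -natrD ler_nat; case: eqP; case: eqP.
Qed.

HB.instance Definition _ := isMetric.Build R initCarrier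
  initDistxx initDist_positivity initDist_sym initDist_triangle.

Fact initDist_le1 (j k : initCarrier) : mdist j k <= 1 :> R.
Proof. by rewrite [mdist _ _]/(initDist j k) /initDist lern1 leq_b1. Qed.
Fact initDist_pt (j k : 'I_i) : j != k ->
  mdist (j : initCarrier) (k : initCarrier) = 1 :> R.
Proof. by move=> jk; rewrite [mdist _ _]/(initDist j k) /initDist jk. Qed.

Definition initObj : ptMetric R i :=
  @PtMetric R i initCarrier (fun j => j) initDist_le1 initDist_pt.

End InitialObject.

Section Colimit.
Context (R : realType) (i : nat).

Fixpoint chain (n : nat) : ptMetric R i :=
  if n is n'.+1 then tensor (chain n') else initObj.

(* M^n (x) !, the unique morphism ! : I -> M (x) I being [pt].                *)
Fixpoint chainMap (n : nat) : chain n -> chain n.+1 :=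
  if n is n'.+1 then tensMap (chainMap (n := n')) else pt (tensor initObj).

Lemma chainMap_pointed n : pointed (@chainMap n).
Proof. by elim: n => [//|n IH]; exact: tensMap_pointed. Qed.

Lemma chainMap_isom n (x y : chain n) :
  mdist (chainMap x) (chainMap y) = mdist x y.
Proof.
elim: n x y => [|n IH] x y; last by apply: tensMap_isom; first exact: chainMap_pointed.
have [->|xy] := eqVneq x y; first by rewrite !mdistxx.
by rewrite (mdist_pt initObj)// (mdist_pt (tensor initObj)).
Qed.

Definition stages := {n : nat & (chain n : choiceType)}.
HB.instance Definition _ := Choice.on stages.
Implicit Types s t : stages.

Definition stage n (x : chain n) : stages := Tagged (fun n => chain n : choiceType) x.

Definition next s : stages := stage (chainMap (tagged s)).

Definition colimRel s t : bool :=
  `[< exists a b, iter a next s = iter b next t >].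

Lemma colimRel_is_equiv : equiv_class_of colimRel.
Proof.
split.
- by move=> s; apply/asboolP; exists 0%N, 0%N.
- by move=> s t; apply/asboolP/asboolP => -[a [b e]]; exists b, a.
- move=> t s u /asboolP[a [b e]] /asboolP[c [d e']]; apply/asboolP.
  by exists (c + a)%N, (b + d)%N; rewrite !iterD e -e' -!iterD addnC.
Qed.

Canonical colimRel_equiv := EquivRelPack colimRel_is_equiv.

Definition colimCarrier := {eq_quot colimRel}.
HB.instance Definition _ := Choice.on colimCarrier.
HB.instance Definition _ := EqQuotient.on colimCarrier.

(* The distance of two elements of the same stage. *)
Definition stageDist s t : R := mdist (tagged s : chain _) (tagged_as s t).

(* The distance is computed in the common stage [tag s + tag t]. *)
Definition preDist s t : R :=
  stageDist (iter (tag t) next s) (iter (tag s) next t).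

Definition colimDist (u v : colimCarrier) : R := preDist (repr u) (repr v).

Lemma stageDistE n (x y : chain n) : stageDist (stage x) (stage y) = mdist x y.
Proof. by rewrite /stageDist tagged_asE. Qed.

Lemma tag_next a s : tag (iter a next s) = (a + tag s)%N.
Proof. by elim: a => //= a ->. Qed.

Lemma same_stage s t : tag s = tag t ->
  exists n (x y : chain n), s = stage x /\ t = stage y.
Proof. by case: s t => [n x] [m y] /= e; subst m; exists n, x, y. Qed.

Lemma stageDist_next k s t : tag s = tag t ->
  stageDist (iter k next s) (iter k next t) = stageDist s t.
Proof.
move=> e; elim: k => // k <- /=.
have [|n [x [y [-> ->]]]] := @same_stage (iter k next s) (iter k next t).
  by rewrite !tag_next e.
by rewrite [LHS]stageDistE chainMap_isom stageDistE.
Qed.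

Lemma preDistE a b s t : (a + tag s = b + tag t)%N ->
  preDist s t = stageDist (iter a next s) (iter b next t).
Proof.
move=> e; rewrite /preDist -(stageDist_next a); last by rewrite !tag_next addnC.
rewrite -(stageDist_next (tag t) (s := iter a next s)); last first.
  by rewrite !tag_next.
by rewrite -!iterD addnC [(_ + b)%N]addnC -e.
Qed.

Lemma preDist_rel s s' t : colimRel s s' -> preDist s t = preDist s' t.
Proof.
move=> /asboolP[a [b e]].
have et : (a + tag s = b + tag s')%N by rewrite -!tag_next e.
rewrite (@preDistE (tag t + a) (a + tag s)); last lia.
rewrite (@preDistE (tag t + b) (a + tag s) s').
  by rewrite !iterD e.
lia.
Qed.

Lemma preDist_sym s t : preDist s t = preDist t s.
Proof.
rewrite /preDist.
have [|n [x [y [-> ->]]]] := @same_stage (iter (tag t) next s) (iter (tag s) next t).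
  by rewrite !tag_next addnC.
by rewrite !stageDistE metric_sym.
Qed.

Lemma colimDist_pi s t :
  colimDist (\pi_colimCarrier s) (\pi_colimCarrier t) = preDist s t.
Proof.
have r u : colimRel (repr (\pi_colimCarrier u)) u by apply/eqmodP; rewrite reprK.
by rewrite /colimDist (preDist_rel _ (r s)) preDist_sym (preDist_rel _ (r t))
  preDist_sym.
Qed.

Definition cls n (x : chain n) : colimCarrier := \pi_colimCarrier (stage x).

Lemma cls_next n (x : chain n) : cls (chainMap x) = cls x.
Proof. by apply/eqmodP/asboolP; exists 0%N, 1%N. Qed.

Lemma cls_surj u : exists n (x : chain n), u = cls x.
Proof. by case: (repr u) (reprK u) => n x <-; exists n, x. Qed.

Lemma cls_lift k n (x : chain n) : (n <= k)%N ->
  exists y : chain k, cls x = cls y.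
Proof.
move=> nk; have tk := tag_next (k - n) (stage x).
rewrite /= subnK// in tk; have ck : colimRel (stage x) (iter (k - n) next (stage x)).
  by apply/asboolP; exists (k - n)%N, 0%N.
by case: (iter _ _ _) tk ck => m y /= e /eqmodP c; subst m; exists y.
Qed.

Lemma cls3 u v w : exists n (x y z : chain n),
  [/\ u = cls x, v = cls y & w = cls z].
Proof.
have [n [x ->]] := cls_surj u; have [m [y ->]] := cls_surj v.
have [l [z ->]] := cls_surj w; pose k := (n + m + l)%N.
have [|x' ->] := @cls_lift k _ x; first by rewrite /k; lia.
have [|y' ->] := @cls_lift k _ y; first by rewrite /k; lia.
have [|z' ->] := @cls_lift k _ z; first by rewrite /k; lia.
by exists k, x', y', z'.
Qed.

Lemma cls2 u v : exists n (x y : chain n), u = cls x /\ v = cls y.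
Proof. by have [n [x [y [_ [-> -> _]]]]] := cls3 u v v; exists n, x, y. Qed.

Lemma colimDist_cls n (x y : chain n) : colimDist (cls x) (cls y) = mdist x y.
Proof.
by rewrite colimDist_pi (@preDistE 0 0)//= stageDistE.
Qed.

Fact colimDistxx u : colimDist u u = 0.
Proof. by have [n [x [y [-> _]]]] := cls2 u u; rewrite colimDist_cls mdistxx. Qed.

Fact colimDist_positivity u v : colimDist u v = 0 -> u = v.
Proof.
have [n [x [y [-> ->]]]] := cls2 u v.
by rewrite colimDist_cls => /mdist_positivity ->.
Qed.

Fact colimDist_sym u v : colimDist u v = colimDist v u.
Proof. exact: preDist_sym. Qed.

Fact colimDist_triangle v u w : colimDist u w <= colimDist u v + colimDist v w.
Proof.
have [n [x [y [z [-> -> ->]]]]] := cls3 u v w.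
by rewrite !colimDist_cls metric_triangle.
Qed.

HB.instance Definition _ := isMetric.Build R colimCarrier
  colimDistxx colimDist_positivity colimDist_sym colimDist_triangle.

Definition colimPt (j : 'I_i) : colimCarrier := cls (pt (chain 0) j).

Fact colimDist_le1 (u v : colimCarrier) : mdist u v <= 1.
Proof.
have [n [x [y [-> ->]]]] := cls2 u v.
by rewrite [mdist _ _]colimDist_cls mdist_le1.
Qed.

Fact colimDist_pt j k : j != k -> mdist (colimPt j) (colimPt k) = 1.
Proof. by move=> jk; rewrite [mdist _ _]colimDist_cls mdist_pt. Qed.

Definition G : ptMetric R i :=
  @PtMetric R i colimCarrier colimPt colimDist_le1 colimDist_pt.

Lemma mdist_cls n (x y : chain n) : mdist (cls x : G) (cls y) = mdist x y.
Proof. exact: colimDist_cls. Qed.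

Lemma cls_pt n j : cls (pt (chain n) j) = pt G j.
Proof. by elim: n => // n <-; rewrite -chainMap_pointed cls_next. Qed.

(* [gCopy m] is [x] |-> [m (x) x], and g (m (x) [x]) = [m (x) x]: see [gE].   *)
Definition gCopy (m : 'I_i) (u : G) : G :=
  let s := repr (u : colimCarrier) in
  cls (tens m (tagged s) : chain (tag s).+1).

Definition g (u : tensor G) : G :=
  let p := repr (u : tensCarrier G) in gCopy p.1 p.2.

Lemma gCopyE m n (x : chain n) :
  gCopy m (cls x) = cls (tens m x : chain n.+1).
Proof.
pose tstep s : stages := stage (tens m (tagged s) : chain (tag s).+1).
have tstepE k s : tstep (iter k next s) = iter k next (tstep s).
  elim: k => //= k <-; congr stage; rewrite /= tensMapE//.
  exact: chainMap_pointed.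
have /eqmodP/asboolP[a [b e]] := reprK (cls x).
by apply/eqmodP/asboolP; exists a, b; rewrite -!tstepE e.
Qed.

Lemma gE m n (x : chain n) :
  g (tens m (cls x : G)) = cls (tens m x : chain n.+1).
Proof.
rewrite /g; have /eqmodP/tensRelP := reprK (tens m (cls x : G)).
rewrite -gCopyE; case: (repr _) => m' c [[-> ->//]|/glueP[/= _ -> ->]].
by rewrite /= /colimPt !gCopyE (tens_glue (chain 0)).
Qed.

Lemma g_pointed : pointed (X := tensor G) (Y := G) g.
Proof. by move=> j; rewrite /= /colimPt gE (cls_pt 1). Qed.

Lemma cls_morphism n : morphism MS_S (@cls n : chain n -> G).
Proof.
split; first exact: cls_pt.
by move=> x y; rewrite mul1r mdist_cls.
Qed.

Lemma g_isom u v : mdist (g u) (g v) = mdist u v.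
Proof.
move: u v; apply: tensor_ind => m u; apply: tensor_ind => k v.
have [n [x [y [-> ->]]]] := cls2 u v.
rewrite !gE mdist_cls !mdist_tens (tensForm_isom (f := @cls n : chain n -> G))//.
- exact: cls_pt.
- exact: mdist_cls.
Qed.

Lemma g_morphism K : morphism K (X := tensor G) (Y := G) g.
Proof.
apply: morphism_of_S; split; first exact: g_pointed.
by move=> u v; rewrite mul1r g_isom.
Qed.

(* (G, g) as an algebra in any of the three categories.                       *)
Definition GAlgebra (K : category) : algebra R i K :=
  Algebra (g_morphism K).

(* The universal property that identifies (G, g).                             *)
Section Initiality.
Variable B : algebra R i MS_S.

Fixpoint chainRec n : chain n -> B :=
  if n is n'.+1 then str (a := B) \o tensMap (chainRec (n := n')) else pt B.

Lemma chainRec_morphism n : morphism MS_S (@chainRec n).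
Proof.
elim: n => [|n IH] /=.
  split=> // j k; rewrite mul1r.
  have [->|jk] := eqVneq j k; first by rewrite !mdistxx.
  by rewrite (mdist_pt initObj)// mdist_le1.
exact: morphism_comp_S (tensMap_short IH) (str_morphism B).
Qed.

Lemma chainRec_next n (x : chain n) : chainRec (chainMap x) = chainRec x.
Proof.
elim: n x => [|n IH] x.
  by have [+ _] := chainRec_morphism 1; apply.
move: x; apply: tensor_ind => m x /=; have [cpt _] := chainRec_morphism n.
have [cpt' _] := chainRec_morphism n.+1.
rewrite (tensMapE m x (@chainMap_pointed n)) (tensMapE _ _ cpt').
by rewrite (tensMapE _ _ cpt) -IH.
Qed.

Definition colimRec (u : G) : B :=
  chainRec (tagged (repr (u : colimCarrier))).

Lemma colimRecE n (x : chain n) : colimRec (cls x) = chainRec x.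
Proof.
have h k s : chainRec (tagged (iter k next s)) = chainRec (tagged s).
  by elim: k => //= k <-; rewrite -[RHS]chainRec_next.
have /eqmodP/asboolP[a [b e]] := reprK (cls x).
by rewrite /colimRec -(h a) e h.
Qed.

End Initiality.

Theorem GAlgebra_initial : isInitialAlgebra (GAlgebra MS_S).
Proof.
move=> B; exists (@colimRec B); split.
  have cpt : pointed (@colimRec B).
    by move=> j; rewrite -(cls_pt 0) colimRecE; case: (chainRec_morphism B 0).
  split.
    split=> // u v; have [n [x [y [-> ->]]]] := cls2 u v.
    by rewrite mdist_cls !colimRecE; case: (chainRec_morphism B n).
  apply/funext => u /=; move: u; apply: tensor_ind => m u.
  have [n [x ->]] := cls_surj u.
  rewrite gE colimRecE tensMapE// colimRecE /=.
  by rewrite tensMapE//; case: (chainRec_morphism B n).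
move=> f [[fpt _] fg]; apply/funext => u.
have [n [x ->]] := cls_surj u; rewrite colimRecE.
elim: n x {u} => [|n IH] x; first exact: (esym (fpt x)).
move: x; apply: tensor_ind => m x /=.
have := congr1 (fun h => h (tens m (cls x : G))) fg; rewrite /= gE => ->.
by rewrite !tensMapE ?IH//; case: (chainRec_morphism B n).
Qed.

End Colimit.

(* Main.v *)
Require Import Defs.
From mathcomp Require Import all_boot all_order all_algebra.
From mathcomp Require Import all_classical all_reals all_analysis.
From mathcomp Require Import lra.

(** Lipschitz and continuous structure maps, unlike short ones, may expand
    distances by the factor 2 that the functor contracts them by, and this is
    enough to break the universal property of [G].  On the initial object [I],
    the set of names of the distinguished points, send [m (x) j] to
    [max m j].  This respects the gluing because [max] is symmetric and
    preserves the distinguished points because [max] is idempotent; it is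
    2-Lipschitz because distinct points of [M (x) I] are at distance at least
    1/2 ([maxStr_lipschitz]), hence it is continuous.

    Let [j < k] be two names.  The points [j (x) ... (x) j (x) k] of [G]
    converge to the distinguished point [j], since each further factor halves
    the distance.  An algebra morphism to [I] sends every one of them to
    [max j (... (max j k)) = k], but sends their limit to [j]; so it is not
    continuous ([algebra_map_discontinuous]).  As Lipschitz maps are continuous,
    neither category has a morphism from [G] to this algebra. *)

Set Implicit Arguments.
Unset Strict Implicit.
Unset Printing Implicit Defensive.
Import Order.TTheory GRing.Theory Num.Theory.
Local Open Scope ring_scope.

Lemma lipschitz_continuous (R : realType) (i : nat) (X Y : ptMetric R i)
  (f : X -> Y) (k : R) : lipschitzWith k f -> continuous f.
Proof.
move=> fk x; apply/(@metricType_numDomainType.cvgrPdist_lt R Y) => e e0.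
(* The constant [k] may be 0 or negative, hence [|k| + 1]. *)
have k0 : 0 < `|k| + 1 by have := normr_ge0 k; lra.
apply/(@metricType_numDomainType.nbhs_mdistP R X).
exists (e / (`|k| + 1)) => [|y]; first by rewrite /= divr_gt0.
rewrite /= ltr_pdivlMr// mulrC; apply/le_lt_trans/(le_trans (fk _ _)).
by rewrite ler_wpM2r ?mdist_ge0//; have := ler_norm k; lra.
Qed.

Section MaxAlgebra.
Context {R : realType} {i : nat}.
Local Notation I := (@initObj R i).

Definition maxStr (u : tensor I) : I :=
  let p := repr (u : tensCarrier I) in Order.max (p.1 : 'I_i) (p.2 : 'I_i).

Lemma maxStrE (m j : 'I_i) : maxStr (tens m (j : I)) = Order.max m j.
Proof.
rewrite /maxStr; have /eqmodP/tensRelP := reprK (tens m (j : I)).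
by case: (repr _) => m' j' [[-> ->//]|/glueP[/= _ -> ->]]; exact: maxC.
Qed.

Lemma maxStr_pointed : pointed maxStr.
Proof. by move=> j; rewrite /= maxStrE maxxx. Qed.

Lemma maxStr_lipschitz : lipschitzWith 2 maxStr.
Proof.
have dist (j k : @initCarrier i) : mdist j k = (j != k)%:R :> R by [].
apply: tensor_ind => m j; apply: tensor_ind => n k.
rewrite mdist_tens mulrC !maxStrE.
(* Twice a distance in [M (x) I] is a sum of distances 0 or 1.  Between distinct
   copies it vanishes only for the two sides of the gluing relation, where
   [max] is symmetric; if it is at least 1, the bound is trivial. *)
case: tensFormP => /= [<-|_|l _ _ _]; rewrite divfK ?pnatr_eq0//.
- have [->|jk] := eqVneq j k; first by rewrite !mdistxx.
  by apply: le_trans (initDist_le1 _ _) _; rewrite (dist j) jk.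
- have [->|jn] := eqVneq j n; last first.
    apply: le_trans (initDist_le1 _ _) _.
    by rewrite (dist j) jn lerDl mdist_ge0.
  have [->|mk] := eqVneq m k; first by rewrite maxC !mdistxx addr0.
  apply: le_trans (initDist_le1 _ _) _.
  by rewrite (dist m) mk lerDr mdist_ge0.
- apply: le_trans (initDist_le1 _ _) _.
  by rewrite addrAC lerDr addr_ge0 ?mdist_ge0.
Qed.

End MaxAlgebra.

Section Discontinuity.
Context {R : realType} {i : nat}.
Local Notation G := (G R i).
Local Notation I := (@initObj R i).
Local Notation copy m := (fun v : G => g (tens m v) : G).

(** The copy [m] of [G] in [G] contains the distinguished point [m], fixed by
    the contraction [m (x) _] of ratio 1/2. *)
Lemma mdist_iter_copy (m : 'I_i) (u : G) (n : nat) :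
  mdist (pt G m) (iter n (copy m) u) =
  mdist (pt G m) u / 2 ^+ n.
Proof.
elim: n => [|n IH]; first by rewrite divr1.
rewrite iterS -{1}(g_pointed R m) [LHS]g_isom mdist_tens_same IH.
by rewrite exprSr invfM mulrA.
Qed.

Lemma algebra_map_discontinuous (j k : 'I_i) (f : G -> I) : (j < k)%O ->
  pointed f -> (@g R i : tensor G -> G) \; f = tensMap f \; maxStr ->
  ~ continuous f.
Proof.
move=> jk fpt fg fc.
have [e e0 near_j] : exists2 e : R, 0 < e &
    forall v : G, mdist (pt G j) v < e -> mdist (f (pt G j)) (f v) < 1.
  have := fc (pt G j).
  move=> /(@metricType_numDomainType.cvgrPdist_lt R I) /(_ 1 ltr01).
  move=> /(@metricType_numDomainType.nbhs_mdistP R G) [e e0 near_j].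
  by exists e => // v; exact: near_j.
have fiter n : f (iter n (copy j) (pt G k)) = pt I k.
  elim: n => [|n IH]; first exact: fpt.
  have := congr1 (fun h => h (tens j (iter n (copy j) (pt G k)))) fg.
  by rewrite /= => ->; rewrite tensMapE// IH maxStrE max_r// ltW.
have := near_j (iter (Num.bound e^-1) (copy j) (pt G k)).
rewrite fiter fpt mdist_iter_copy !mdist_pt ?(lt_eqF jk)// ltxx => far.
suff : false by []; apply: far.
by rewrite mul1r invf_plt ?posrE ?exprn_gt0//; exact: upper_nthrootP.
Qed.

Lemma GAlgebra_not_initial (K : category) : (1 < i)%N ->
  morphism K (@maxStr R i) ->
  (forall f : G -> I, morphism K f -> continuous f) ->
  ~ isInitialAlgebra (GAlgebra R i K).
Proof.
move=> i1 maxK Kc /(_ (Algebra maxK)) [f [[fK fg] _]].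
apply: (@algebra_map_discontinuous (Ordinal (ltnW i1)) (Ordinal i1) f).
- by [].
- by case: fK.
- exact: fg.
- exact: Kc.
Qed.

End Discontinuity.

Theorem mainTheorem4 (R : realType) (i : nat) (hi : i = 2%N \/ i = 3%N) :
  ~ isInitialAlgebra (GAlgebra R i MS_C) /\
  ~ isInitialAlgebra (GAlgebra R i MS_L).
Proof.
have i1 : (1 < i)%N by case: hi => ->.
split; apply: GAlgebra_not_initial => //.
- split; first exact: maxStr_pointed.
  exact: lipschitz_continuous maxStr_lipschitz.
- by move=> f [].
- split; first exact: maxStr_pointed.
  by exists 2; exact: maxStr_lipschitz.
- by move=> f [_ [k fk]]; exact: lipschitz_continuous fk.
Qed.
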